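(* Assume $\pi\ge0$ and let $\mathbf r$ be an arbitrary $L\times L$ stochastic matrix. Let $j$ be such that $m_j:=\sum_{i=1}^L\sigma_i r_{ij}>0$. Define $$g_j(d)=\frac{1}{m_j}\sum_{i=1}^L\sigma_i r_{ij}\Big(\sqrt\alpha\,h_{ij}-\pi\alpha\big(d-\sqrt\alpha\,h_{jj}\big)\Big)^+-d,\qquad d\in\mathbb R .$$ Then $g_j$ has a unique zero $\bar d_j^*$. Moreover, almost surely $\bar D_{j,t}\to\bar d_j^*$ as $t\to\infty$. Equivalently, with $N_j(d)=\min\{i:\ h_{ij}>\sqrt\alpha\,\pi(d-\sqrt\alpha h_{jj})\}$ (and sums over an empty index set equal to $0$), $\bar d_j^*$ is the unique solution of $$\bar d_j^*=\frac{\sqrt\alpha\sum_{i=N_j(\bar d_j^* )}^{L}\sigma_i r_{ij}\big(h_{ij}+\pi\alpha h_{jj}\big)}{\sum_{i=1}^L\sigma_i r_{ij}+\pi\alpha\sum_{i=N_j(\bar d_j^* )}^{L}\sigma_i r_{ij}}.$$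
   Context: Supply-chain model. The parameters are a price-sensitivity $\alpha\in(0,1]$, a manufacturer's per-unit production cost $C_m\ge0$, and a supplier's per-unit procurement cost $C_s\ge0$. For $x\in\mathbb R$ write $x^+=\max\{0,x\}$. The market potential takes values $\phi_1<\dots<\phi_L$ with probabilities $\sigma_1,\dots,\sigma_L>0$ summing to $1$, and $\phi_1>\alpha(C_s+C_m)$. Set $$h_{ij}=\frac{2\phi_i-\phi_j-\alpha(C_m+C_s)}{4\sqrt\alpha},\qquad q^*(\phi)=\frac{\phi+\alpha(C_s-C_m)}{2\alpha}.$$ Dynamic system. Let $\mathbf r=(r_{ij})$ be an $L\times L$ stochastic matrix (nonnegative entries, rows summing to $1$); over- and under-reporting are both allowed. The pairs $(\Phi_t,\hat\Phi_t)$, $t=1,2,\dots$, are i.i.d. with $P(\Phi_t=\phi_i,\hat\Phi_t=\phi_j)=\sigma_i r_{ij}$. Here $\Phi_t$ is the true potential in slot $t$ and $\hat\Phi_t$ is the reported one. The noises $\{\mathcal N_t\}$ are i.i.d., bounded, have zero mean, and are independent of $\{(\Phi_t,\hat\Phi_t)\}$. Fix a penalty parameter $\pi$ and, for each $j$, an arbitrary initial value $\bar D_{j,0}\in\mathbb R$. For $t\ge1$, define $\bar D_{j,t}$ as the average of $D_s$ over the slots $s\le t$ with $\hat\Phi_s=\phi_j$, namely $$\bar D_{j,t}=\frac{\sum_{s\le t}D_s\mathbf 1\{\hat\Phi_s=\phi_j\}}{\sum_{s\le t}\mathbf 1\{\hat\Phi_s=\phi_j\}}.$$ If no such slot exists yet,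 set $\bar D_{j,t}=\bar D_{j,0}$. In slot $t$, if $\hat\Phi_t=\phi_j$, the supplier quotes $$Q_t=q^*(\phi_j)+2\pi\big(\bar D_{j,t-1}-\sqrt\alpha\,h_{jj}\big).$$ The manufacturer then sets $$P_t=\frac{\Phi_t+\alpha(Q_t+C_m)}{2\alpha},$$ and the realized demand is $$D_t=(\Phi_t-\alpha P_t)^++\mathcal N_t .$$ *)

(* Defs.v *)
From HB Require Import structures.
From mathcomp Require Import all_boot all_order all_algebra.
From mathcomp Require Import all_classical all_reals all_analysis.
Set Implicit Arguments. Unset Strict Implicit. Unset Printing Implicit Defensive.
Import Order.TTheory GRing.Theory Num.Theory.
Import numFieldNormedType.Exports.
Local Open Scope classical_set_scope.
Local Open Scope ring_scope.

Section Model.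
Variables (R : realType) (L : nat).

Definition pos (x : R) : R := Num.max 0 x.

Definition hh (alpha Cm Cs : R) (phi : 'I_L -> R) (i j : 'I_L) : R :=
  (2 * phi i - phi j - alpha * (Cm + Cs)) / (4 * Num.sqrt alpha).

Definition qstar (alpha Cm Cs : R) (x : R) : R :=
  (x + alpha * (Cs - Cm)) / (2 * alpha).

(* realized demand in a slot with true potential phi_i, reported phi_j,
   current running average db = \bar D_{j,t-1}, and noise n *)
Definition demand (alpha Cm Cs pi : R) (phi : 'I_L -> R)
    (i j : 'I_L) (db n : R) : R :=
  let Q := qstar alpha Cm Cs (phi j)
           + 2 * pi * (db - Num.sqrt alpha * hh alpha Cm Cs phi j j) in
  let P := (phi i + alpha * (Q + Cm)) / (2 * alpha) in
  pos (phi i - alpha * P) + n.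

(* running statistics: for each j, (number of slots with report j, sum of D) *)
Definition dbar_of (init : 'I_L -> R) (s : 'I_L -> nat * R) (j : 'I_L) : R :=
  if (s j).1 == 0%N then init j else (s j).2 / ((s j).1)%:R.

(* Slot t+1 (t = 0,1,...) uses true index tru t, reported index rep t and
   noise nz t.  stats t = statistics after slots 1..t. *)
Fixpoint stats (alpha Cm Cs pi : R) (phi : 'I_L -> R) (init : 'I_L -> R)
    (tru rep : nat -> 'I_L) (nz : nat -> R) (t : nat) : 'I_L -> nat * R :=
  match t with
  | 0%N => fun _ => (0%N, 0)
  | t'.+1 =>
      let s := stats alpha Cm Cs pi phi init tru rep nz t' in
      let j := rep t' in
      let D := demand alpha Cm Cs pi phi (tru t') j (dbar_of init s j) (nz t') in
      fun k => if k == j then (((s k).1).+1, (s k).2 + D) else s k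
  end.

Definition Dbar (alpha Cm Cs pi : R) (phi init : 'I_L -> R)
    (tru rep : nat -> 'I_L) (nz : nat -> R) (j : 'I_L) (t : nat) : R :=
  dbar_of init (stats alpha Cm Cs pi phi init tru rep nz t) j.

Definition gfun (alpha Cm Cs pi : R) (phi sigma : 'I_L -> R) (r : 'M[R]_L)
    (j : 'I_L) (d : R) : R :=
  (\sum_(i < L) sigma i * r i j)^-1 *
  (\sum_(i < L) sigma i * r i j *
     pos (Num.sqrt alpha * hh alpha Cm Cs phi i j
          - pi * alpha * (d - Num.sqrt alpha * hh alpha Cm Cs phi j j)))
  - d.

(* N_j(d) = min { i : h_ij > sqrt(alpha) pi (d - sqrt(alpha) h_jj) }, 0-based;
   equals L if the set is empty (then sums over i >= N_j(d) are empty). *)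
Definition Nj (alpha Cm Cs pi : R) (phi : 'I_L -> R) (j : 'I_L) (d : R) : nat :=
  find (fun i : 'I_L => Num.sqrt alpha * pi * (d - Num.sqrt alpha * hh alpha Cm Cs phi j j)
                        < hh alpha Cm Cs phi i j) (enum 'I_L).

Definition closed_rhs (alpha Cm Cs pi : R) (phi sigma : 'I_L -> R) (r : 'M[R]_L)
    (j : 'I_L) (d : R) : R :=
  let N := Nj alpha Cm Cs pi phi j d in
  Num.sqrt alpha *
    (\sum_(i < L | (N <= i)%N) sigma i * r i j *
        (hh alpha Cm Cs phi i j + pi * alpha * hh alpha Cm Cs phi j j))
  / (\sum_(i < L) sigma i * r i j
     + pi * alpha * \sum_(i < L | (N <= i)%N) sigma i * r i j).

End Model.

(* Mutual independence of the whole family consisting of the pairs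
   X t = (index of Phi_{t+1}, index of hat Phi_{t+1}) and the noises N t:
   product rule over every finite subfamily. *)
Definition mutually_indep {d} {T : measurableType d} {R : realType}
    (P : probability T R) {L : nat}
    (X : nat -> T -> 'I_L * 'I_L) (N : nat -> T -> R) : Prop :=
  forall (s1 s2 : seq nat) (A : nat -> set ('I_L * 'I_L)) (B : nat -> set R),
    uniq s1 -> uniq s2 -> (forall t, measurable (B t)) ->
    fine (P ((\bigcap_(t in [set` s1]) (X t @^-1` A t))
             `&` (\bigcap_(t in [set` s2]) (N t @^-1` B t))))
    = (\prod_(t <- s1) fine (P (X t @^-1` A t)))
      * (\prod_(t <- s2) fine (P (N t @^-1` B t))).

(* Main.v *)
(** Let [S_t] and [c_t] be the total demand and the number of the first [t] slots
with report [j], and [V_t = S_t - d* c_t], so that the running average exceeds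
[d*] by [V_t / c_t].  Let [U_t] be the same sum with every quote frozen at the
one for [d*]: it is a sum of i.i.d. centered terms, so [U_t = o(t)] by the
strong law of large numbers.  Demand is nonincreasing in the running average,
hence [V] grows no faster than [U] while positive and decreases no faster than
[U] while negative; as its steps are bounded this forces [V_t = o(t)], whereas
[c_t] grows linearly.

The strong law is proved for pairwise independent events (second moments along
the squares); the noise is reduced to events by cutting its range into small
levels. *)
Require Import Defs.
From HB Require Import structures.
From mathcomp Require Import all_boot all_order all_algebra.
From mathcomp Require Import all_classical all_reals all_analysis.
From mathcomp Require Import measurable_realfun.
From mathcomp Require Import ring lra.
Import Order.TTheory GRing.Theory Num.Theory.
Import numFieldNormedType.Exports.
Local Open Scope classical_set_scope.
Local Open Scope ring_scope.
Set Implicit Arguments.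
Unset Strict Implicit.

(** * Sequences that are [o(n)] *)

Section Sublinear.
Context {R : realType}.
Implicit Types u v : nat -> R.

(** This is [u n = o(n)], with the finitely many early terms absorbed by [C]. Bounds valid for all
    [n] can be added and used in inductions without any limit. *)
Definition sublinear u :=
  forall e : R, 0 < e -> exists C, forall n, `|u n| <= C + e * n%:R.

Lemma sublinear_eq u v : u =1 v -> sublinear u -> sublinear v.
Proof. by move=> uv su e /su[C uC]; exists C => n; rewrite -uv. Qed.

Lemma sublinearD u v :
  sublinear u -> sublinear v -> sublinear (fun n => u n + v n).
Proof.
move=> su sv e e0; have e20 : 0 < e / 2 by rewrite divr_gt0.
have [C uC] := su _ e20; have [D vD] := sv _ e20; exists (C + D) => n.
have := ler_normD (u n) (v n); have := uC n; have := vD n; lra.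
Qed.

Lemma sublinearZ c u : sublinear u -> sublinear (fun n => c * u n).
Proof.
move=> su e e0; have d0 : 0 < `|c| + 1 by rewrite ltr_wpDl.
have [C uC] := su _ (divr_gt0 e0 d0); exists ((`|c| + 1) * C) => n.
rewrite normrM (@le_trans _ _ ((`|c| + 1) * `|u n|)) ?ler_wpM2r ?lerDl //.
apply: (le_trans (ler_wpM2l (ltW d0) (uC n))).
suff -> : (`|c| + 1) * (C + e / (`|c| + 1) * n%:R) =
  (`|c| + 1) * C + e * n%:R by [].
by field; rewrite gt_eqF.
Qed.

Lemma sublinear_sum (I : Type) (s : seq I) (f : I -> nat -> R) :
  (forall i, sublinear (f i)) -> sublinear (fun n => \sum_(i <- s) f i n).
Proof.
move=> sf; elim: s => [|i s IH].
  by move=> e e0; exists 0 => n; rewrite big_nil normr0 add0r mulr_ge0 // ltW.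
by apply: sublinear_eq (sublinearD (sf i) IH) => n; rewrite big_cons.
Qed.

Lemma sqrn_bounds n : exists k, (k ^ 2 <= n < k.+1 ^ 2)%N.
Proof.
elim: n => [|n [k /andP[kn nk]]]; first by exists 0%N.
have [nk'|kn'] := ltnP n.+1 (k.+1 ^ 2); first by exists k; rewrite leqW.
by exists k.+1; rewrite kn' (leq_ltn_trans nk) // ltn_sqr.
Qed.

(* Between consecutive squares [u] moves by at most [2 k], which is [o(k^2)]. *)
Lemma sublinear_squares u :
  (forall n, `|u n.+1 - u n| <= 1) ->
  (forall e, 0 < e -> exists C, forall k, `|u (k ^ 2)%N| <= C + e * (k ^ 2)%:R) ->
  sublinear u.
Proof.
move=> u1 su e e0.
have e20 : 0 < e / 2 by rewrite divr_gt0.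
have [C uC] := su _ e20; exists (C + 2 / e) => n.
have [k /andP[kn nk]] := sqrn_bounds n.
have du i : `|u (k ^ 2 + i)%N - u (k ^ 2)%N| <= i%:R.
  elim: i => [|i IH]; first by rewrite addn0 subrr normr0.
  rewrite addnS; have := u1 (k ^ 2 + i)%N; rewrite !ler_norml -natr1 in IH *.
  by lra.
have := du (n - k ^ 2)%N; rewrite subnKC // natrB //.
have nk' : n%:R <= (k ^ 2)%:R + 2 * k%:R :> R.
  rewrite -natrM -natrD ler_nat -ltnS; move: nk.
  by rewrite -[k.+1]addn1 sqrnD muln1 exp1n addn1 addSn.
have kn' : (k ^ 2)%:R <= n%:R :> R by rewrite ler_nat.
(* The distance [n - k^2] is at most [2 k]. Expanding [(2 - e k)^2 >= 0] splits this into a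
   constant, the [2 / e] chosen above, and a part charged to [e / 2 * k^2]. *)
have kk : 2 * k%:R <= 2 / e + e / 2 * (k ^ 2)%:R.
  rewrite -subr_ge0 natrX.
  suff -> : 2 / e + e / 2 * k%:R ^+ 2 - 2 * k%:R =
    (2 - e * k%:R) ^+ 2 / (2 * e) by rewrite divr_ge0 ?sqr_ge0 ?mulr_ge0 ?ltW.
  by field; rewrite gt_eqF.
have := uC k.
rewrite !ler_norml => /andP[]; nra.
Qed.

(** The induction bounds [v - u] on both sides. While [v n > 0] the difference cannot increase, so
    its upper bound persists; its lower bound at [n.+1] follows from [v n.+1 >= - K] and the bound
    on [u]. The case [v n < 0] is symmetric, and from [v n = 0] a single step moves [v] by at most
    [K]. *)
Lemma sublinear_dominated u v K :
  `|v 0%N| <= K -> u 0%N = 0 ->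
  (forall n, `|v n.+1 - v n| <= K) ->
  (forall n, 0 < v n -> v n.+1 - v n <= u n.+1 - u n) ->
  (forall n, v n < 0 -> u n.+1 - u n <= v n.+1 - v n) ->
  sublinear u -> sublinear v.
Proof.
move=> v0 u0 dv vp vn su e e0.
have e20 : 0 < e / 2 by rewrite divr_gt0.
have [C uC] := su _ e20; exists (K + 2 * C) => n.
have h : `|v n - u n| <= K + (C + e / 2 * n%:R).
  elim: n => [|n IH].
    have := uC 0%N; rewrite u0 subr0 normr0 mulr0n mulr0; lra.
  have := uC n.+1; have := dv n; rewrite -[n.+1%:R]natr1 !ler_norml in IH *.
  move: IH => /andP[IH1 IH2] /andP[d1 d2] /andP[U1 U2].
  case: (ltrgtP (v n) 0) => hv.
  - have := vn _ hv; lra.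
  - have := vp _ hv; lra.
  - lra.
have := uC n; move: h; rewrite !ler_norml; lra.
Qed.

Lemma sublinear_ratio_cvg (x v c : nat -> R) (l m : R) :
  0 < m -> sublinear v -> sublinear (fun n => c n - m * n%:R) ->
  (forall n, 0 < c n -> x n - l = v n / c n) ->
  x n @[n --> \oo] --> l.
Proof.
move=> m0 sv sc xE; apply/cvgrPdist_le => /= e e0.
have m20 : 0 < m / 2 by rewrite divr_gt0.
have em0 : 0 < e * m / 4 by rewrite divr_gt0 ?mulr_gt0.
have [C cC] := sc _ m20; have [D vD] := sv _ em0.
near=> n.
(* Since [c n >= m / 2 * n - C], this threshold gives [c n >= 1]. The next one makes
   [D + e * m / 4 * n], the bound on [v n], at most [e * (m / 2 * n - C)]. *)
have nC : (C + 1) * 2 / m <= n%:R by near: n; exact: nbhs_infty_ger.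
have nD : (D + e * C) * 4 / m / e <= n%:R by near: n; exact: nbhs_infty_ger.
rewrite !ler_pdivrMr // in nC nD.
have := cC n; rewrite ler_norml => /andP[c1 _].
have c0 : 0 < c n by lra.
rewrite distrC xE // normrM normfV (gtr0_norm c0) ler_pdivrMr //.
apply: (le_trans (vD n)); have := ler_wpM2l (ltW e0) (_ : m / 2 * n%:R - C <= c n).
by move=> /(_ _); rewrite mulrBr; lra.
Unshelve. all: end_near. Qed.

End Sublinear.

(** * The function [g_j]: monotonicity, its zero, and the closed form *)

Section Demand.
Context {R : realType} {L : nat}.
Variables (alpha Cm Cs pi : R) (phi sigma : 'I_L -> R) (r : 'M[R]_L) (j : 'I_L).
Hypotheses (alpha0 : 0 < alpha) (pi0 : 0 <= pi).

Let h i := hh alpha Cm Cs phi i j.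
Let sa := Num.sqrt alpha.
Let w i := sigma i * r i j.
Let m := \sum_(i < L) w i.
Let g := gfun alpha Cm Cs pi phi sigma r j.

Definition mean_demand (i : 'I_L) (d : R) : R :=
  pos (Num.sqrt alpha * hh alpha Cm Cs phi i j
       - pi * alpha * (d - Num.sqrt alpha * hh alpha Cm Cs phi j j)).

Let sa0 : 0 < sa. Proof. by rewrite sqrtr_gt0. Qed.

Lemma sqrt_hh i : sa * h i = (2 * phi i - phi j - alpha * (Cm + Cs)) / 4.
Proof. by rewrite /h /hh -/sa; field; rewrite gt_eqF. Qed.

(** Substituting the price gives [phi i - alpha P = (phi i - alpha (Q + Cm)) / 2], and substituting
    the quote turns this into the argument of the positive part in [g_j]. *)
Lemma demandE i d n :
  demand alpha Cm Cs pi phi i j d n = mean_demand i d + n.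
Proof.
rewrite /demand /mean_demand -!/sa -!/(h _) !sqrt_hh /qstar.
congr (pos _ + n); by field; rewrite gt_eqF.
Qed.

Lemma pos_ge0 (x : R) : 0 <= pos x.
Proof. by rewrite /pos le_max lexx. Qed.

Lemma mean_demand_ge0 i d : 0 <= mean_demand i d.
Proof. exact: pos_ge0. Qed.

Lemma mean_demand_nincr i (d d' : R) :
  d <= d' -> mean_demand i d' <= mean_demand i d.
Proof.
move=> dd'; rewrite /mean_demand /pos ge_max !le_max lexx /=.
by apply/orP; right; rewrite lerD2l lerN2 ler_wpM2l ?lerD2r // mulr_ge0 // ltW.
Qed.

Hypotheses (w0 : forall i, 0 <= w i) (m0 : 0 < m).

Lemma gfunE d : m * (g d + d) = \sum_(i < L) w i * mean_demand i d.
Proof. by rewrite /g /gfun subrK mulrA mulfV ?gt_eqF // mul1r. Qed.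

(** The averaged demand is nonincreasing in [d], and the term [- d] makes the decrease strict. *)
Lemma gfun_decr (d d' : R) : d < d' -> g d' < g d.
Proof.
move=> dd'; have : g d' + d' <= g d + d; last lra.
rewrite -(ler_pM2l m0) !gfunE ler_sum // => i _.
by rewrite ler_wpM2l // mean_demand_nincr // ltW.
Qed.

Lemma gfun_inj : injective g.
Proof.
by move=> d d' e; case: (ltrgtP d d') => // /gfun_decr; rewrite e ltxx.
Qed.

Lemma mean_demand_continuous i : continuous (mean_demand i).
Proof.
move=> x; apply: (@continuous_max _ _ (fun=> 0) (fun d => sa * h i
  - pi * alpha * (d - sa * h j)) x); first exact: cst_continuous.
apply: cvgB; first exact: cvg_cst.
apply: cvgM; first exact: cvg_cst.
by apply: cvgB; [exact: cvg_id|exact: cvg_cst].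
Qed.

Lemma gfun_continuous : continuous g.
Proof.
move=> x; apply: cvgB; last exact: cvg_id.
apply: cvgM; first exact: cvg_cst.
apply: cvg_big => [|i _]; first exact: add_continuous.
apply: cvgM; first exact: cvg_cst.
exact: mean_demand_continuous.
Qed.

(** The intermediate value theorem applies on [[0, g 0]]. Demands are nonnegative, so [g 0 >= 0];
    the averaged demand at [g 0] is at most that at [0], which is [g 0] itself, so
    [g (g 0) <= 0]. *)
Lemma gfun_root : exists d, g d = 0.
Proof.
have g0 : 0 <= g 0.
  rewrite -(pmulr_rge0 _ m0) -[g 0]addr0 gfunE sumr_ge0 // => i _.
  by rewrite mulr_ge0 // mean_demand_ge0.
have g1 : g (g 0) <= 0.
  have : g (g 0) + g 0 <= g 0 + 0; last lra.
  rewrite -(ler_pM2l m0) !gfunE ler_sum // => i _.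
  by rewrite ler_wpM2l // mean_demand_nincr.
have [||d _ gd] := @IVT _ g 0 (g 0) 0 g0.
- by apply: continuous_subspaceT => x; exact: gfun_continuous.
- by rewrite ge_min g1 orbT le_max g0.
- by exists d.
Qed.

Hypothesis phi_incr : forall i k : 'I_L, (i < k)%N -> phi i < phi k.

(** As [h_ij] increases with [phi i], the indices above the threshold form a final segment, so the
    first one found determines the whole set. *)
Lemma Nj_leP d (i : 'I_L) : (Nj alpha Cm Cs pi phi j d <= i)%N =
  (sa * pi * (d - sa * h j) < h i).
Proof.
rewrite /Nj -!/(h _) -/sa; set p := fun i : 'I_L => _.
rewrite -[RHS]/(p i); apply/idP/idP => [Ni|pi_]; last first.
  rewrite leqNgt; apply/negP => /(before_find i).
  by rewrite nth_ord_enum pi_.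
have hp : has p (enum 'I_L).
  by rewrite has_find size_enum_ord (leq_ltn_trans Ni).
have := nth_find i hp; set k := nth _ _ _ => pk.
have ki : (k <= i)%N.
  by rewrite /k nth_enum_ord // (leq_ltn_trans Ni).
apply: (lt_le_trans pk); rewrite -(ler_pM2l sa0) !sqrt_hh ler_pM2r ?invr_gt0 //.
rewrite !lerB // ler_pM2l //.
by move: ki; rewrite leq_eqVlt => /orP[/eqP/val_inj ->|/phi_incr/ltW].
Qed.

(** With [alpha] written as the square of [sa], the argument of the positive part is [sa] times
    [h i] minus the threshold of [N_j]; hence the positive part vanishes exactly below [N_j]. *)
Lemma sum_mean_demand d : \sum_(i < L) w i * mean_demand i d =
  \sum_(i < L | (Nj alpha Cm Cs pi phi j d <= i)%N)
     w i * (sa * h i - pi * alpha * (d - sa * h j)).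
Proof.
rewrite [RHS]big_mkcond; apply: eq_bigr => i _; rewrite Nj_leP.
have -> : pi * alpha * (d - sa * h j) = sa * (sa * pi * (d - sa * h j)).
  by rewrite -{1}(sqr_sqrtr (ltW alpha0)) -/sa; ring.
rewrite /mean_demand /pos -!/(h _) -!/sa.
have -> : pi * alpha * (d - sa * h j) = sa * (sa * pi * (d - sa * h j)).
  by rewrite -{1}(sqr_sqrtr (ltW alpha0)) -/sa; ring.
rewrite -mulrBr; case: ltP => hi.
  by rewrite max_r // pmulr_rge0 // subr_ge0 ltW.
by rewrite max_l ?mulr0 // pmulr_rle0 // subr_le0.
Qed.

(** Once the positive parts are replaced by the sum over [i >= N], both equations are the same
    linear relation in [d] with the same [N], and the coefficient [m + pi * alpha * W] is
    positive. *)
Lemma gfun_eq0 d :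
  g d = 0 <-> d = closed_rhs alpha Cm Cs pi phi sigma r j d.
Proof.
rewrite /closed_rhs; set N := Nj _ _ _ _ _ _ _.
rewrite -/m -!/sa; set W := (\sum_(i < L | _) sigma i * r i j).
set H := (\sum_(i < L | _) _ * _).
have W0 : 0 <= W by apply: sumr_ge0 => i _; exact: w0.
have den0 : m + pi * alpha * W != 0.
  by rewrite gt_eqF // ltr_wpDr // !mulr_ge0 // ltW.
have E : m * (g d + d) = sa * H - pi * alpha * d * W.
  rewrite gfunE sum_mean_demand -/N mulr_sumr mulr_sumr -sumrB.
  by apply: eq_bigr => i _; rewrite -/(h _) -/(h _) /w; ring.
split=> [gd|dE].
  apply: (canRL (mulfK den0)); rewrite gd add0r in E; rewrite mulrDr mulrC E; ring.
have e : d * (m + pi * alpha * W) = sa * H by rewrite {1}dE mulfVK.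
have : m * (g d + d) = m * d by rewrite E -e; ring.
by move/(mulfI (lt0r_neq0 m0)); lra.
Qed.

End Demand.

(** * Convergence along one fixed path with regular frequencies and noise *)

Section Path.
Context {R : realType} {L : nat}.
Variables (alpha Cm Cs pi : R) (phi sigma : 'I_L -> R) (r : 'M[R]_L).
Variables (init : 'I_L -> R) (j : 'I_L).
Variables (tru rep : nat -> 'I_L) (nz : nat -> R) (M dstar : R).
Hypotheses (alpha0 : 0 < alpha) (pi0 : 0 <= pi).
Hypothesis nzM : forall t, `|nz t| <= M.
Hypothesis m0 : 0 < \sum_(i < L) sigma i * r i j.
Hypothesis dstar0 : gfun alpha Cm Cs pi phi sigma r j dstar = 0.

Let F := mean_demand alpha Cm Cs pi phi j.
(** Index shift: [s t] and [x t] describe the state after [t] slots, while [tru t], [rep t] and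
    [nz t] belong to slot [t+1], whose quote therefore uses [x t]. *)
Let s t := stats alpha Cm Cs pi phi init tru rep nz t j.
Let x t := Dbar alpha Cm Cs pi phi init tru rep nz j t.
Let e t : R := (rep t == j)%:R.
Let b i t : R := ((tru t, rep t) == (i, j))%:R.
Let c t : R := (s t).1%:R.
Let V t := (s t).2 - dstar * c t.
(* [V] with the demand frozen at its value for [dstar]. *)
Let U n := \sum_(t < n) e t * (F (tru t) dstar + nz t - dstar).

Hypothesis freq : forall i,
  sublinear (fun n => \sum_(t < n) b i t - sigma i * r i j * n%:R).
Hypothesis noise : forall i, sublinear (fun n => \sum_(t < n) b i t * nz t).

Let cS t : c t.+1 = c t + e t.
Proof.
rewrite /c /s /e /= eq_sym; case: eqP => [_|_]; last by rewrite addr0.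
by rewrite /= natr1.
Qed.

Let SS t : (s t.+1).2 = (s t).2 + e t * (F (tru t) (x t) + nz t).
Proof.
rewrite /s /e /= eq_sym; case: eqP => [->|_]; last by rewrite mul0r addr0.
by rewrite mul1r /= demandE.
Qed.

Let xE t : 0 < c t -> x t = (s t).2 / c t.
Proof.
by rewrite /x /Dbar /dbar_of -/(s t) /c; case: eqP => // ->; rewrite ltxx.
Qed.

(** Sorting the slots with report [j] by their true state reduces every sum to the finitely many
    sums controlled by [freq] and [noise]. *)
Let split_state (G : 'I_L -> R) t : e t * G (tru t) = \sum_(i < L) b i t * G i.
Proof.
rewrite (bigD1 (tru t)) //= big1 => [|i it]; last first.
  by rewrite /b xpair_eqE eq_sym (negbTE it) mul0r.
by rewrite addr0 /b xpair_eqE eqxx.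
Qed.

Let cE n : c n = \sum_(i < L) \sum_(t < n) b i t.
Proof.
rewrite exchange_big /=; elim: n => [|n IH]; first by rewrite big_ord0.
rewrite cS IH big_ord_recr /=; congr (_ + _).
rewrite -[LHS]mulr1 (split_state (fun=> 1)).
by apply: eq_bigr => i _; rewrite mulr1.
Qed.

Let c_sublinear :
  sublinear (fun n => c n - (\sum_(i < L) sigma i * r i j) * n%:R).
Proof.
apply: sublinear_eq (sublinear_sum (index_enum 'I_L) freq) => n.
by rewrite cE mulr_suml -sumrB.
Qed.

Let U_sublinear : sublinear U.
Proof.
have := sublinear_sum (index_enum 'I_L)
  (fun i => sublinearD (sublinearZ (F i dstar - dstar) (freq i)) (noise i)).
apply: sublinear_eq => n /=; rewrite /U.
under [RHS]eq_bigr do rewrite (split_state (fun i => F i dstar + nz _ - dstar)).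
rewrite exchange_big /=.
have w0 : \sum_(i < L) (F i dstar - dstar) * (sigma i * r i j) = 0.
  under eq_bigr do rewrite mulrBl mulrC.
  rewrite sumrB -mulr_sumr -(gfunE alpha Cm Cs pi phi m0) dstar0; ring.
rewrite -[RHS]subr0 -[X in _ - X](mulr0 n%:R) -[X in _ - _ * X]w0 mulr_sumr -sumrB.
apply: eq_bigr => i _.
have -> : \sum_(t < n) b i t * (F i dstar + nz t - dstar) =
    (F i dstar - dstar) * \sum_(t < n) b i t + \sum_(t < n) b i t * nz t.
  by rewrite mulr_sumr -big_split; apply: eq_bigr => t _ /=; ring.
ring.
Qed.

Let M0 : 0 <= M. Proof. exact: le_trans (nzM 0%N). Qed.

(** Each demand is at least [- M], and before the first report the average is [init j]. Through
    monotonicity this lower bound caps the demand, so the steps of [V] are bounded. *)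
Let x_ge t : - (M + `|init j|) <= x t.
Proof.
have S_ge n : - M * c n <= (s n).2.
  elim: n => [|n IH]; first by rewrite mulr0.
  rewrite cS SS mulrDr lerD // mulrC /e ler_wpM2l //.
  have := mean_demand_ge0 alpha Cm Cs pi phi j (tru n) (x n).
  by have := nzM n; rewrite -/F ler_norml; lra.
have := normr_ge0 (init j); case: (ltrP 0 (c t)) => ct.
  have : - M <= x t by rewrite xE // ler_pdivlMr.
  lra.
rewrite /x /Dbar /dbar_of -/(s t) ifT; last by rewrite -(pnatr_eq0 R) eq_le ct /=.
by have := ler_norm (- init j); rewrite normrN; have := M0; lra.
Qed.

Let B := \sum_(i < L) F i (- (M + `|init j|)).

Let F_le i t : F i (x t) <= B.
Proof.
apply: (@le_trans _ _ (F i (- (M + `|init j|)))); first exact: mean_demand_nincr.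
rewrite /B (bigD1 i) //= lerDl sumr_ge0 // => k _; exact: mean_demand_ge0.
Qed.

Let VS t : V t.+1 - V t = e t * (F (tru t) (x t) + nz t - dstar).
Proof. by rewrite /V cS SS; ring. Qed.

Let US t : U t.+1 - U t = e t * (F (tru t) dstar + nz t - dstar).
Proof. by rewrite /U big_ord_recr /=; ring. Qed.

Let e0 t : 0 <= e t. Proof. exact: ler0n. Qed.

(** Before the first report both [c] and the total demand are zero, so a nonzero [V] guarantees that
    [x] is a genuine average. *)
Let c0 t : V t != 0 -> 0 < c t.
Proof.
apply: contraNT; rewrite -leNgt => ct.
suff [ct0 st0] : c t = 0 /\ (s t).2 = 0 by rewrite /V ct0 st0 mulr0 subrr.
elim: t ct => [//|t IH]; rewrite cS SS => ct.
have ct' : 0 <= c t by exact: ler0n.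
have et : e t = 0 by have := e0 t; lra.
by have [->->] := IH ltac:(lra); rewrite et mul0r addr0.
Qed.

Let VE t : 0 < c t -> V t = c t * (x t - dstar).
Proof. by move=> ct; rewrite /V xE //; field; rewrite gt_eqF. Qed.

Lemma Dbar_cvg_path : x n @[n --> \oo] --> dstar.
Proof.
apply: (@sublinear_ratio_cvg _ x V c dstar _ m0); last first.
- by move=> n cn; rewrite VE // mulrAC mulfV ?mul1r // gt_eqF.
- exact: c_sublinear.
apply: (@sublinear_dominated _ U V (B + M + `|dstar|)) U_sublinear.
- rewrite /V /c /= mulr0 subrr normr0.
  by rewrite !addr_ge0 // sumr_ge0 // => i _; exact: mean_demand_ge0.
- by rewrite /U big_ord0.
- move=> t; rewrite VS normrM ger0_norm //.
  apply: (@le_trans _ _ (1 * `|F (tru t) (x t) + nz t - dstar|)).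
    by rewrite ler_wpM2r // /e lern1 leq_b1.
  rewrite mul1r (le_trans (ler_normB _ _)) // lerD2r.
  rewrite (le_trans (ler_normD _ _)) // lerD //.
  by rewrite ger0_norm ?mean_demand_ge0.
- move=> t Vt; rewrite VS US ler_wpM2l // !lerD2r.
  apply: mean_demand_nincr => //.
  have ct := c0 (lt0r_neq0 Vt); move: Vt.
  by rewrite VE // pmulr_rgt0 // subr_gt0 => /ltW.
- move=> t Vt; rewrite VS US ler_wpM2l // !lerD2r.
  apply: mean_demand_nincr => //.
  have ct := c0 (ltr0_neq0 Vt); move: Vt.
  by rewrite VE // pmulr_rlt0 // subr_lt0 => /ltW.
Qed.

End Path.

(** * Strong law of large numbers for pairwise independent events *)

Section Probability.
Context {d} {T : measurableType d} {R : realType} (P : probability T R).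

Lemma bounded_integrable (f : T -> R) C : measurable_fun setT f ->
  (forall w, `|f w| <= C) -> P.-integrable setT (EFin \o f).
Proof.
move=> mf fC; apply: measurable_bounded_integrable => //.
  by rewrite ltey_eq fin_num_measure.
exists C; split; first exact: num_real.
by move=> y Cy w _; exact: le_trans (fC w) (ltW Cy).
Qed.

Lemma Rintegral_cstT (c : R) : \int[P]_w c = c.
Proof.
rewrite Rintegral_cst // -[RHS]mulr1; congr (_ * _).
by rewrite -[RHS](congr1 fine (probability_setT P)).
Qed.

Lemma Rintegral_sum (I : Type) (s : seq I) (f : I -> T -> R) :
  (forall i, P.-integrable setT (EFin \o f i)) ->
  \int[P]_w (\sum_(i <- s) f i w) = \sum_(i <- s) \int[P]_w f i w.
Proof.
move=> fi; elim: s => [|i s IH].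
  under eq_Rintegral do rewrite big_nil.
  by rewrite Rintegral_cst // big_nil mul0r.
under eq_Rintegral do rewrite big_cons.
rewrite RintegralD // ?IH ?big_cons //.
have := @integrable_sum _ T R P setT measurableT _ s xpredT (fun i => EFin \o f i).
move=> /(_ (fun i _ => fi i)); congr (integrable _ _ _).
by apply/funext => w /=; rewrite sumEFin.
Qed.

(** By monotone convergence the series has a finite integral, hence a finite sum almost everywhere,
    and its terms tend to zero there. *)
Lemma summable_mean_cvg0 (f : nat -> T -> R) C :
  (forall k, measurable_fun setT (f k)) -> (forall k w, 0 <= f k w) ->
  (forall n, (\sum_(k < n) \int[P]_w (f k w)%:E <= C%:E)%E) ->
  {ae P, forall w, f k w @[k --> \oo] --> 0}.
Proof.
move=> mf f0 fC.
pose S (w : T) : \bar R := (\sum_(k <oo) (f k w)%:E)%E.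
have S0 w : (0 <= S w)%E by apply: nneseries_ge0 => k _ _; rewrite lee_fin.
have mS : measurable_fun setT S.
  apply: ge0_emeasurable_sum => k; first by move=> w _ _; rewrite lee_fin.
  by move=> _; exact/measurable_EFinP.
have iS : P.-integrable setT S.
  apply/integrableP; split => //.
  under eq_integral do rewrite gee0_abs //.
  rewrite integral_nneseries //; last first.
  - by move=> k w _; rewrite lee_fin.
  - by move=> k; exact/measurable_EFinP.
  apply: (@le_lt_trans _ _ C%:E); last exact: ltry.
  apply: lime_le.
    by apply: is_cvg_nneseries => k _ _; apply: integral_ge0 => w _; rewrite lee_fin.
  by apply: nearW => n; rewrite big_mkord.
have := integrable_ae measurableT iS.
apply: filterS => w /(_ I) Sw.
apply: cvg_series_cvg_0; apply: nondecreasing_is_cvgn.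
  by apply: nondecreasing_series => n _ _; exact: f0.
exists (fine (S w)) => _ [n _ <-].
rewrite -lee_fin fineK // /series /= -sumEFin.
by apply: nneseries_lim_ge => k _ _; rewrite lee_fin.
Qed.

Lemma sum_inv_sqr_le n : \sum_(k < n) (k.+1%:R ^+ 2)^-1 <= 2 :> R.
Proof.
case: n => [|n]; first by rewrite big_ord0.
(* The strengthened bound is what makes the induction telescope. *)
suff : \sum_(k < n.+1) (k.+1%:R ^+ 2)^-1 <= 2 - n.+1%:R^-1 :> R.
  by move=> /le_trans; apply; rewrite lerBlDr lerDl invr_ge0.
elim: n => [|n IH].
  by rewrite big_ord_recr big_ord0 /= expr1n invr1 add0r; lra.
rewrite big_ord_recr /=; apply: (le_trans (lerD IH (lexx _))).
have n0 : 0 < n.+1%:R :> R by rewrite ltr0n.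
rewrite -[n.+2%:R]natr1; set x := n.+1%:R in n0 *.
rewrite -subr_ge0.
have -> : 2 - (x + 1)^-1 - (2 - x^-1 + ((x + 1) ^+ 2)^-1) =
   (x * (x + 1) ^+ 2)^-1.
  by field; rewrite !gt_eqF // addr_gt0.
by rewrite invr_ge0 mulr_ge0 ?sqr_ge0 // ltW.
Qed.

Variables (E : nat -> set T) (p : R).
Hypothesis mE : forall t, measurable (E t).
Hypothesis PE : forall t, fine (P (E t)) = p.
Hypothesis PEE : forall s t, s != t -> fine (P (E s `&` E t)) = p * p.

Let Y t (w : T) : R := \1_(E t) w - p.
Let S n w : R := \sum_(t < n) Y t w.

Let p01 : 0 <= p <= 1.
Proof.
rewrite -(PE 0%N) fine_ge0 //= -lee_fin fineK ?probability_le1 //.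
exact: fin_num_measure.
Qed.

Let Y1 t w : `|Y t w| <= 1.
Proof.
have /andP[p0 p1] := p01.
by rewrite /Y indicE; case: (_ \in _); rewrite ler_norml /=; lra.
Qed.

Let mY t : measurable_fun setT (Y t).
Proof. by apply: measurable_funB => //; exact: measurable_indic. Qed.

Let iYY s t : P.-integrable setT (EFin \o (fun w => Y s w * Y t w)).
Proof.
apply: (@bounded_integrable _ 1); first exact: measurable_funM.
by move=> w; rewrite normrM mulr_ile1.
Qed.

Let YY s t : \int[P]_w (Y s w * Y t w) = if s == t then p - p * p else 0.
Proof.
have ii A : measurable A -> P.-integrable setT (EFin \o \1_A).
  by move=> mA; exact: integrable_indic.
have I A : measurable A -> \int[P]_w (\1_A w) = fine (P A).
  by move=> mA; rewrite /Rintegral integral_indic // setIT.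
(* Expanding [(Y s + p) (Y t + p)], the indicator of the intersection, leaves only integrals known
   from [PE] and [PEE]. *)
have -> : \int[P]_w (Y s w * Y t w) =
    \int[P]_w (\1_(E s `&` E t) w - (p * (Y s w + Y t w) + p * p)).
  apply: eq_Rintegral => w _; rewrite indicI /Y /=; ring.
have iY u : P.-integrable setT (EFin \o Y u).
  exact: (@bounded_integrable _ 1).
have iYD : P.-integrable setT (EFin \o (fun w => Y s w + Y t w)).
  exact: (integrableD measurableT (iY s) (iY t)).
have iYZ : P.-integrable setT (EFin \o (fun w => p * (Y s w + Y t w))).
  exact: (integrableZl measurableT p iYD).
have ic c : P.-integrable setT (EFin \o (fun=> c)).
  exact: finite_measure_integrable_cst.
have Y0 u : \int[P]_w Y u w = 0.
  by rewrite RintegralB ?I ?PE ?Rintegral_cstT ?subrr //; exact: ii.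
rewrite RintegralB //; last 2 first.
- exact: ii (measurableI _ _ _ _).
- exact: (integrableD measurableT iYZ (ic (p * p))).
rewrite RintegralD // RintegralZl // RintegralD // !Y0 addr0 mulr0 add0r.
rewrite Rintegral_cstT I; last exact: measurableI.
case: eqVneq => [->|st]; first by rewrite setIid PE.
by rewrite PEE // subrr.
Qed.

Lemma second_moment n : \int[P]_w (S n w ^+ 2) = n%:R * (p - p * p).
Proof.
have -> : \int[P]_w (S n w ^+ 2) =
    \int[P]_w (\sum_(st : 'I_n * 'I_n) Y st.1 w * Y st.2 w).
  apply: eq_Rintegral => w _.
  by rewrite expr2 /S big_distrlr pair_bigA.
rewrite Rintegral_sum //.
under eq_bigr do rewrite YY.
rewrite -(pair_bigA _ (fun s t : 'I_n => if val s == val t then p - p * p else 0)) /=.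
rewrite -[n in RHS]card_ord mulr_natl -sumr_const; apply: eq_bigr => s _.
by rewrite -big_mkcond (big_pred1 s) // => t; rewrite eq_sym.
Qed.

(** At [n = k^2] the second moment of [S n / n] is at most [1 / k^2], which is summable, so these
    averages tend to zero almost surely; the increments are at most 1, which fills the gaps between
    squares. *)
Lemma event_slln :
  {ae P, forall w, sublinear (fun n => \sum_(t < n) \1_(E t) w - p * n%:R)}.
Proof.
have mS n : measurable_fun setT (S n) by exact: measurable_sum.
have S_le n w : `|S n w| <= n%:R.
  rewrite (le_trans (ler_norm_sum _ _ _)) //.
  rewrite -[n in leRHS]card_ord -sumr_const ler_sum //.
(* The shift to [k.+1] avoids dividing by zero; the square [0], where the sum is empty, is treated
   separately below. *)
pose f k w := (S (k.+1 ^ 2)%N w / (k.+1 ^ 2)%:R) ^+ 2.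
have mf k : measurable_fun setT (f k).
  by apply: measurable_funX; apply: measurable_funM.
have f0 k w : 0 <= f k w by exact: sqr_ge0.
have fle k : (\int[P]_w (f k w)%:E <= ((k.+1%:R ^+ 2)^-1)%:E)%E.
  have n0 : 0 < (k.+1 ^ 2)%:R :> R by rewrite ltr0n.
  have iS : P.-integrable setT (EFin \o (fun w => S (k.+1 ^ 2)%N w ^+ 2)).
    apply: (@bounded_integrable _ ((k.+1 ^ 2)%:R ^+ 2)).
      exact: measurable_funX.
    by move=> w; rewrite normrX ler_sqr ?nnegrE.
  have if_ : P.-integrable setT (EFin \o f k).
    have := integrableZl measurableT ((k.+1 ^ 2)%:R ^- 2) iS.
    congr (integrable _ _ _); apply/funext => w /=.
    by rewrite /f expr_div_n -EFinM mulrC.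
  rewrite -(fineK (integrable_fin_num measurableT if_)) lee_fin.
  have -> : fine (\int[P]_w (f k w)%:E) =
      \int[P]_w (S (k.+1 ^ 2)%N w ^+ 2 * (k.+1 ^ 2)%:R ^- 2).
    by apply: eq_Rintegral => w _; rewrite /f expr_div_n.
  rewrite RintegralZr // second_moment -[k.+1%:R ^+ 2]natrX.
  have /andP[p0 p1] := p01.
  have -> : (k.+1 ^ 2)%:R * (p - p * p) * (k.+1 ^ 2)%:R ^- 2 =
     (p - p * p) / (k.+1 ^ 2)%:R by field; rewrite gt_eqF.
  rewrite ler_pdivrMr // mulVf ?gt_eqF //; nra.
have sle n : (\sum_(k < n) \int[P]_w (f k w)%:E <= 2%:E)%E.
  apply: (@le_trans _ _ (\sum_(k < n) (k.+1%:R ^+ 2)^-1)%:E).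
    by rewrite -sumEFin; apply: lee_sum.
  by rewrite lee_fin sum_inv_sqr_le.
apply: filterS (summable_mean_cvg0 mf f0 sle) => w fw.
have Sw n : \sum_(t < n) \1_(E t) w - p * n%:R = S n w.
  rewrite /S sumrB sumr_const card_ord mulr_natr //.
apply: (@sublinear_eq _ (S ^~ w)) => [n|]; first by rewrite Sw.
apply: sublinear_squares => [n|].
  by rewrite /S big_ord_recr /= addrAC subrr add0r Y1.
move=> e e0.
suff [C CS] : exists C, forall k, `|S (k.+1 ^ 2)%N w| <= C + e * (k.+1 ^ 2)%:R.
  exists `|C| => -[|k].
    by rewrite /S big_ord0 normr0 addr_ge0 // mulr_ge0 // ltW.
  by rewrite (le_trans (CS k)) // lerD2r ler_norm.
have [n0 _ fn0] : \forall k \near \oo, `|f k w| < e ^+ 2.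
  by move/cvgr0Pnorm_lt : fw; apply; rewrite exprn_gt0.
(* The finitely many squares before the limit takes effect are covered by the sum of their absolute
   values. *)
exists (\sum_(i < n0) `|S (i.+1 ^ 2)%N w|) => k.
have [kn0|n0k] := ltnP k n0.
  rewrite (bigD1 (Ordinal kn0)) //= -addrA lerDl addr_ge0 ?sumr_ge0 //.
  by rewrite mulr_ge0 // ltW.
have e_ge0 := ltW e0; have := fn0 k n0k; rewrite /= /f normrX.
rewrite ltr_sqr ?nnegrE // normrM normfV normr_nat.
rewrite ltr_pdivrMr ?ltr0n // => /ltW/le_trans; apply.
by rewrite lerDr sumr_ge0.
Qed.

End Probability.

(** * Rounding bounded values to finitely many levels *)

Section Levels.
Context {R : realType}.

(** Counting the positive multiples of [dl] up to [y] rounds [y] down to the grid, with an error of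
    at most one mesh. *)
Lemma levels_approx (y dl : R) K : 0 < dl -> 0 <= y <= K%:R * dl ->
  0 <= y - dl * \sum_(l < K) (l.+1%:R * dl <= y)%R%:R <= dl.
Proof.
move=> dl0; elim: K => [|K IH] /andP[y0 yK].
  by rewrite big_ord0 mulr0 subr0 y0 (le_trans yK) // mul0r ltW.
rewrite big_ord_recr /=.
have [yK'|Ky] := lerP y (K%:R * dl).
  rewrite [(_ <= y)%R]leNgt (le_lt_trans yK') ?ltr_pM2r ?ltr_nat // addr0.
  by apply: IH; rewrite y0.
rewrite (eq_bigr (fun=> 1)) => [|l _]; last first.
  by rewrite (le_trans _ (ltW Ky)) // ler_pM2r // ler_nat.
rewrite sumr_const card_ord; rewrite -[K.+1%:R]natr1 in yK *.
by case: (leP _ y) => h; rewrite ?mulr1n ?mulr0n; lra.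
Qed.

(** Shifting by [M] makes [y] nonnegative, and [z] is its rounding shifted back. The factor 3
    collects one [dl] each from the rounding, from the sublinear deviations and from the nearly zero
    mean [dl * \sum_(l < K) q l - M]. *)
Lemma levels_sublinear (b y q : nat -> R) (M w dl : R) K :
  0 < dl -> 2 * M <= K%:R * dl ->
  (forall t, 0 <= b t <= 1) -> (forall t, `|y t| <= M) ->
  sublinear (fun n => \sum_(t < n) b t - w * n%:R) ->
  (forall l, sublinear (fun n =>
     \sum_(t < n) b t * (l.+1%:R * dl <= y t + M)%R%:R - w * q l * n%:R)) ->
  `|w * (dl * \sum_(l < K) q l - M)| <= dl ->
  exists C, forall n, `|\sum_(t < n) b t * y t| <= C + 3 * dl * n%:R.
Proof.
move=> dl0 MK b01 yM sb sl wq.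
pose z t := dl * \sum_(l < K) (l.+1%:R * dl <= y t + M)%R%:R - M.
have yz t : `|b t * (y t - z t)| <= dl.
  have /andP[b0 b1] := b01 t; have := yM t; rewrite ler_norml => /andP[y1 y2].
  have /(levels_approx dl0) : 0 <= y t + M <= K%:R * dl by lra.
  have -> : forall x, y t + M - dl * x = y t - (dl * x - M) by move=> x; ring.
  rewrite -/(z t) => /andP[z0 z1].
  by rewrite normrM !ger0_norm // -[leRHS]mul1r ler_pM.
have := sublinearD (sublinearZ (- M) sb)
  (sublinearZ dl (sublinear_sum (index_enum 'I_K) (fun l => sl (val l)))).
move=> /(_ _ dl0)[C h]; exists C => n.
have zE : \sum_(t < n) b t * z t = (- M * (\sum_(t < n) b t - w * n%:R)
    + dl * \sum_(l < K) (\sum_(t < n) b t * (l.+1%:R * dl <= y t + M)%R%:R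
      - w * q l * n%:R)) + w * (dl * \sum_(l < K) q l - M) * n%:R.
  rewrite sumrB exchange_big /= -mulr_suml -mulr_sumr.
  have -> : \sum_(t < n) b t * z t = dl * \sum_(t < n) \sum_(l < K)
      b t * (l.+1%:R * dl <= y t + M)%R%:R - M * \sum_(t < n) b t.
    rewrite !mulr_sumr -sumrB; apply: eq_bigr => t _.
    by rewrite -mulr_sumr /z; ring.
  by ring.
have -> : \sum_(t < n) b t * y t =
    \sum_(t < n) b t * (y t - z t) + \sum_(t < n) b t * z t.
  by rewrite -big_split; apply: eq_bigr => t _ /=; ring.
rewrite (le_trans (ler_normD _ _)) // zE.
have h1 : `|\sum_(t < n) b t * (y t - z t)| <= dl * n%:R.
  rewrite (le_trans (ler_norm_sum _ _ _)) // mulr_natr.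
  by rewrite -[n in leRHS]card_ord -sumr_const ler_sum.
have h2 : `|w * (dl * \sum_(l < K) q l - M) * n%:R| <= dl * n%:R.
  by rewrite normrM normr_nat ler_wpM2r.
apply: (le_trans (lerD h1 (le_trans (ler_normD _ _) (lerD (h n) h2)))).
by lra.
Qed.

End Levels.

(** * Almost sure frequencies and noise averages for the model *)

Section Noise.
Context {R : realType} {L : nat} {d : measure_display} {T : measurableType d}.
Variables (P : probability T R) (X : nat -> T -> 'I_L * 'I_L) (N : nat -> T -> R).
Hypothesis mX : forall t ik, measurable (X t @^-1` [set ik]).
Hypothesis mN : forall t, measurable_fun setT (N t).
Hypothesis NN : forall t (B : set R), measurable B ->
  P (N t @^-1` B) = P (N 0%N @^-1` B).
Hypothesis XN : mutually_indep P X N.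
Variables (ik : 'I_L * 'I_L) (w M : R).
Hypothesis PX : forall t, fine (P (X t @^-1` [set ik])) = w.
Hypothesis NM : forall t x, `|N t x| <= M.
Hypothesis N0 : (\int[P]_x (N 0%N x)%:E = 0)%E.

Let b t x : R := (X t x == ik)%:R.

Let mNpre t B : measurable B -> measurable (N t @^-1` B).
Proof. by move=> mB; rewrite -[X in measurable X]setTI; exact: mN. Qed.

(** The strong law is applied to the events that slot [t] has pair [ik] and noise in [B]. The
    product rule on lists of one and of two slots gives their probability and their pairwise
    independence. *)
Lemma joint_freq (B : set R) : measurable B ->
  {ae P, forall x, sublinear (fun n =>
     \sum_(t < n) b t x * \1_(N t @^-1` B) x
     - w * fine (P (N 0%N @^-1` B)) * n%:R)}.
Proof.
move=> mB; pose E t := X t @^-1` [set ik] `&` N t @^-1` B.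
have mE t : measurable (E t) by apply: measurableI => //; exact: mNpre.
have PE t : fine (P (E t)) = w * fine (P (N 0%N @^-1` B)).
  have := @XN [:: t] [:: t] (fun=> [set ik]) (fun=> B) isT isT (fun=> mB).
  rewrite !big_seq1 PX NN // => <-; congr (fine (P (_ `&` _))).
    by apply/seteqP; split => [x Xx s|x]; [rewrite /= inE => /eqP ->|apply; rewrite /= inE].
  by apply/seteqP; split => [x Xx s|x]; [rewrite /= inE => /eqP ->|apply; rewrite /= inE].
have PEE s t : s != t -> fine (P (E s `&` E t)) =
    w * fine (P (N 0%N @^-1` B)) * (w * fine (P (N 0%N @^-1` B))).
  move=> st.
  have u : uniq [:: s; t] by rewrite /= inE st.
  have := @XN _ _ (fun=> [set ik]) (fun=> B) u u (fun=> mB).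
  rewrite !big_cons !big_nil !mulr1 !PX !(NN _ mB) mulrACA => <-.
  have capE (F : nat -> set T) :
      \bigcap_(v in [set` [:: s; t]]) F v = F s `&` F t.
    apply/seteqP; split => [x Fx|x [Fs Ft] v].
      by split; apply: Fx; rewrite /= !inE eqxx ?orbT.
    by rewrite /= !inE => /orP[] /eqP ->.
  by rewrite !capE /E setIACA.
apply: filterS (event_slln mE PE PEE) => x; apply: sublinear_eq => n.
congr (_ - _); apply: eq_bigr => t _.
rewrite indicI /=; congr (_ * _).
rewrite indicE /b; congr ((nat_of_bool _)%:R); apply/idP/idP.
  by rewrite inE /= => ->.
by move=> /eqP Xt; rewrite inE.
Qed.

Lemma freq_ae : {ae P, forall x, sublinear (fun n => \sum_(t < n) b t x - w * n%:R)}.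
Proof.
apply: filterS (joint_freq measurableT) => x; apply: sublinear_eq => n.
rewrite preimage_setT (congr1 fine (probability_setT P)) mulr1.
by congr (_ - _); apply: eq_bigr => t _; rewrite preimage_setT indicT mulr1.
Qed.

(** The rounded noise is within [dl] of the noise pointwise, hence also in mean, and the noise has
    mean zero. *)
Lemma level_mean dl K : 0 < dl -> 2 * M <= K%:R * dl ->
  `|dl * (\sum_(l < K) fine (P (N 0%N @^-1` `[l.+1%:R * dl - M, +oo[))) - M| <= dl.
Proof.
move=> dl0 MK.
pose A l := N 0%N @^-1` `[l.+1%:R * dl - M, +oo[%classic.
have mA l : measurable (A l) by exact: mNpre.
have iA l : P.-integrable setT (EFin \o \1_(A l)) by exact: integrable_indic.
have iS : P.-integrable setT (EFin \o (fun x => \sum_(l < K) \1_(A l) x)).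
  have := @integrable_sum _ T R P setT measurableT _ (index_enum 'I_K) xpredT
    (fun l => EFin \o \1_(A l)) (fun l _ => iA l).
  by congr (integrable _ _ _); apply/funext => x /=; rewrite sumEFin.
have ic c : P.-integrable setT (EFin \o (fun=> c)).
  exact: finite_measure_integrable_cst.
have iZ : P.-integrable setT (EFin \o (fun x => dl * \sum_(l < K) \1_(A l) x)).
  exact: (integrableZl measurableT dl iS).
have iZM : P.-integrable setT
    (EFin \o (fun x => dl * (\sum_(l < K) \1_(A l) x) - M)).
  exact: (integrableB measurableT iZ (ic M)).
have iN : P.-integrable setT (EFin \o N 0%N) by exact: (bounded_integrable P (mN 0%N) (NM 0%N)).
have zN x : `|N 0%N x - (dl * (\sum_(l < K) \1_(A l) x) - M)| <= dl.
  have := NM 0%N x; rewrite ler_norml => /andP[N1 N2].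
  have /(levels_approx dl0) : 0 <= N 0%N x + M <= K%:R * dl by lra.
  have -> : \sum_(l < K) \1_(A l) x =
      \sum_(l < K) (l.+1%:R * dl <= N 0%N x + M)%R%:R :> R.
    apply: eq_bigr => l _; rewrite indicE; congr ((nat_of_bool _)%:R).
    by rewrite -lerBlDr; apply/idP/idP; rewrite inE /A /= in_itv /= andbT.
  by rewrite ler_norml => /andP[]; lra.
have <- : \int[P]_x (dl * (\sum_(l < K) \1_(A l) x) - M) =
    dl * (\sum_(l < K) fine (P (A l))) - M.
  rewrite RintegralB // RintegralZl // Rintegral_cstT Rintegral_sum //.
  congr (_ * _ - _); apply: eq_bigr => l _.
  by rewrite /Rintegral integral_indic // setIT.
have -> : \int[P]_x (dl * (\sum_(l < K) \1_(A l) x) - M) =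
  - \int[P]_x (N 0%N x - (dl * (\sum_(l < K) \1_(A l) x) - M)).
  by rewrite [in RHS]RintegralB // /Rintegral N0 /= sub0r opprK.
have iD : P.-integrable setT
    (EFin \o (fun x => N 0%N x - (dl * (\sum_(l < K) \1_(A l) x) - M))).
  exact: (integrableB measurableT iN iZM).
rewrite normrN (le_trans (le_normr_Rintegral _ _)) //.
rewrite -[leRHS](Rintegral_cstT P) le_Rintegral //.
exact: (integrable_norm iD).
Qed.

Lemma noise_ae : {ae P, forall x, sublinear (fun n => \sum_(t < n) b t x * N t x)}.
Proof.
have w01 : 0 <= w <= 1.
  rewrite -(PX 0%N) fine_ge0 //= -lee_fin fineK ?probability_le1 //.
  exact: fin_num_measure.
pose dl k : R := k.+1%:R^-1.
pose I l k := `[l.+1%:R * dl k - M, +oo[%classic.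
(* The exceptional null set depends on mesh and level, so the meshes are restricted to the countable
   family [1 / (k+1)], over which the null sets can be united. *)
have H : {ae P, forall x, forall k l, sublinear (fun n =>
     \sum_(t < n) b t x * \1_(N t @^-1` I l k) x
     - w * fine (P (N 0%N @^-1` I l k)) * n%:R)}.
  apply: ae_foralln => k; apply: ae_foralln => l.
  by apply: joint_freq; exact: measurable_itv.
apply: filterS2 H freq_ae => x xI xT e e0.
(* This choice ensures [3 * dl k <= e]; [K] below makes the levels cover the range [[0, 2 M]] of the
   shifted noise. *)
pose k := Num.truncn (3 / e).
have dl0 : 0 < dl k by rewrite invr_gt0.
have dle : 3 * dl k <= e.
  have := truncnS_gt (3 / e); rewrite -/k ltr_pdivrMr // => /ltW h.
  by rewrite ler_pdivrMr // mulrC.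
pose K := (Num.truncn (2 * M / dl k)).+1.
have MK : 2 * M <= K%:R * dl k.
  by rewrite -ler_pdivrMr // ltW // truncnS_gt.
have [|||||C CN] := @levels_sublinear _ (b ^~ x) (N ^~ x)
  (fun l => fine (P (N 0%N @^-1` I l k))) M w (dl k) K dl0 MK.
- by move=> t; rewrite /b ler0n lern1 leq_b1.
- by [].
- exact: xT.
- move=> l; apply: sublinear_eq (xI k l) => n; congr (_ - _).
  apply: eq_bigr => t _; congr (_ * _); rewrite indicE; congr ((nat_of_bool _)%:R).
  by rewrite -lerBlDr; apply/idP/idP; rewrite inE /I /= in_itv /= andbT.
- have := level_mean dl0 MK; rewrite normrM; have /andP[w0 w1] := w01.
  by move=> h; rewrite -[leRHS]mul1r ler_pM // ger0_norm.
- exists C => n; apply: (le_trans (CN n)).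
  by rewrite lerD2l ler_wpM2r.
Qed.

End Noise.

(** * Assembly of the analytic, pathwise and probabilistic parts *)

Unset Implicit Arguments.
Set Strict Implicit.

Theorem theorem2 (R : realType) (L : nat)
  (alpha Cm Cs pi : R) (phi sigma : 'I_L -> R) (r : 'M[R]_L)
  (init : 'I_L -> R)
  (d : measure_display) (T : measurableType d) (P : probability T R)
  (X : nat -> T -> 'I_L * 'I_L) (N : nat -> T -> R) (j : 'I_L) :
  0 < alpha -> alpha <= 1 -> 0 <= Cm -> 0 <= Cs -> 0 <= pi ->
  (forall i k : 'I_L, (i < k)%N -> phi i < phi k) ->
  (forall i : 'I_L, val i = 0%N -> alpha * (Cs + Cm) < phi i) ->
  (forall i, 0 < sigma i) -> \sum_(i < L) sigma i = 1 ->
  (forall i k, 0 <= r i k) -> (forall i, \sum_(k < L) r i k = 1) ->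
  (* the pairs: measurable, identically distributed with law sigma_i r_ij *)
  (forall t ik, measurable (X t @^-1` [set ik])) ->
  (forall t (i k : 'I_L), fine (P (X t @^-1` [set (i, k)])) = sigma i * r i k) ->
  (* the noises: measurable, identically distributed, bounded, zero mean *)
  (forall t, measurable_fun setT (N t)) ->
  (forall t (B : set R), measurable B ->
     P (N t @^-1` B) = P (N 0%N @^-1` B)) ->
  (exists M : R, forall t w, `|N t w| <= M) ->
  (forall t, (\int[P]_w (N t w)%:E = 0)%E) ->
  (* pairs i.i.d., noises i.i.d., and the two sequences independent *)
  mutually_indep P X N ->
  0 < \sum_(i < L) sigma i * r i j ->
  exists dstar : R,
    [/\ gfun alpha Cm Cs pi phi sigma r j dstar = 0,
        (forall d', gfun alpha Cm Cs pi phi sigma r j d' = 0 -> d' = dstar),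
        dstar = closed_rhs alpha Cm Cs pi phi sigma r j dstar,
        (forall d', d' = closed_rhs alpha Cm Cs pi phi sigma r j d' -> d' = dstar)
      & {ae P, forall w,
          Dbar alpha Cm Cs pi phi init (fun t => (X t w).1) (fun t => (X t w).2)
               (fun t => N t w) j t @[t --> \oo] --> dstar}].
Proof.
move=> alpha0 _ _ _ pi0 phi_incr _ sigma0 _ r0 _ mX PX mN NN [M NM] N0 XN m0.
have w0 i : 0 <= sigma i * r i j by rewrite mulr_ge0 // ltW.
have [dstar gd] := gfun_root Cm Cs phi alpha0 pi0 w0 m0.
have inj := @gfun_inj _ _ alpha Cm Cs pi phi sigma r j alpha0 pi0 w0 m0.
have closed := @gfun_eq0 _ _ alpha Cm Cs pi phi sigma r j alpha0 pi0 w0 m0 phi_incr.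
exists dstar; split => //.
- by move=> d' gd'; apply: inj; rewrite gd.
- exact/closed.
- by move=> d' /closed gd'; apply: inj; rewrite gd.
(* Only finitely many true states [i] occur, so one null set serves them all. *)
have freqs : {ae P, forall x, forall i, sublinear (fun n =>
    \sum_(t < n) (X t x == (i, j))%:R - sigma i * r i j * n%:R)}.
  by apply: filter_forall => i; exact: (freq_ae mX mN NN XN (fun t => PX t i j)).
have noises : {ae P, forall x, forall i, sublinear (fun n =>
    \sum_(t < n) (X t x == (i, j))%:R * N t x)}.
  apply: filter_forall => i.
  exact: (noise_ae mX mN NN XN (fun t => PX t i j) NM (N0 0%N)).
apply: filterS2 freqs noises => x fx nx.
exact: (Dbar_cvg_path init (tru := fun t => (X t x).1)
  (rep := fun t => (X t x).2) alpha0 pi0 (NM ^~ x) m0 gd fx nx).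
Qed.
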